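(* Consider the $k$-delete recoverable robust problem under budgeted uncertainty $$(\mathrm{P})\qquad \min_{x\in X}\ f^\top x+\max_{s\in S} R(x,s).$$ It can be solved as the (mixed-integer linear) problem $$(\mathrm{Q})\qquad \begin{aligned}\min_{x,\eta,y}\quad & f^\top x+\eta\\ \text{s.t.}\quad & \eta\ \ge\ \kappa_\ell(\nu)+\sum_{i=1}^n\tilde c^{\,\ell}_{\sigma_\nu(i)}(\nu)\,x_{\sigma_\nu(i)}-M(\nu)(1-y_\ell^\nu),\qquad \ell\in\mathcal L,\ \nu\in\mathcal V,\\ & \sum_{\ell\in\mathcal L}y_\ell^\nu=1,\qquad \nu\in\mathcal V,\\ & x\in X,\ \eta\in\mathbb R_{\ge0},\ y^\nu\in\{0,1\}^{|\mathcal L|},\qquad \nu\in\mathcal V.\end{aligned}$$ That is, (P) and (Q) have the same optimal value, and $x^*\in X$ is optimal for (P) if and only if there are $\eta^*,y^*$ such that $(x^*,\eta^*,y^* )$ is optimal for (Q).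
   Context: Data: $n\ge 1$ an integer, $N=\{1,\dots,n\}$; $X\subseteq\{0,1\}^n$ nonempty; $f,\bar c,\Delta c\in\mathbb R^n_{\ge 0}$ (first-stage costs, nominal recovery costs, maximal deviations); $\Gamma,k\in\{0,\dots,n\}$. Budgeted uncertainty: $\mathcal U_\Gamma=\{u\in\{0,1\}^n:\sum_{i=1}^n u_i\le\Gamma\}=\{u^1,\dots,u^M\}$. The scenario set is $S=\{1,\dots,M\}$, where scenario $s$ has costs $c_i^s=\bar c_i+\Delta c_i u_i^s$, $i\in N$. Recovery cost: for $x\in X$, $s\in S$, $$R(x,s)=\min_y\Big\{\sum_{i=1}^n c_i^s y_i:\ y\le x,\ \sum_{i=1}^n y_i\ge\sum_{i=1}^n x_i-k,\ y\in\{0,1\}^n\Big\}.$$ Define $\mathcal V=\{0\}\cup\{\bar c_i:i\in N\}\cup\{\bar c_i+\Delta c_i:i\in N\}$. For $\nu\in\mathcal V$ and $i\in N$ let $c_i(\nu)=\min\{\Delta c_i,\nu-\bar c_i\}$, $$\bar c_i(\nu)=\begin{cases}\nu,&\nu<\bar c_i,\\ \bar c_i,&\nu\ge\bar c_i,\end{cases}\qquad \Delta c_i(\nu)=\begin{cases}0,&\nu<\bar c_i,\\ c_i(\nu),&\nu\ge\bar c_i.\end{cases}$$ Here $\Delta c_i$ without argument is the given deviation, and $\Delta c_i(\nu)$ is the function just defined (likewise for $\bar c_i$ and $\bar c_i(\nu)$). Set $\Delta c_{n+1}=\bar c_{n+1}=0$, so that $\Delta c_{n+1}(\nu)=0$ for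 all $\nu\in\mathcal V$. For each $\nu\in\mathcal V$ let $\sigma_\nu:N\to N$ be a permutation with $\Delta c_{\sigma_\nu(1)}(\nu)\ge\Delta c_{\sigma_\nu(2)}(\nu)\ge\dots\ge\Delta c_{\sigma_\nu(n)}(\nu)$, and put $\sigma_\nu(n+1)=n+1$. Let $\gamma$ be the largest odd integer with $\Gamma+\gamma<n+1$ and $$\mathcal L=\{\Gamma+1,\Gamma+3,\Gamma+5,\dots,\Gamma+\gamma,\ n+1\}$$ (so $\mathcal L=\{n+1\}$ if $\Gamma=n$). For $\nu\in\mathcal V$, $\ell\in\mathcal L$ and $i\in N$ define $$\tilde c^{\,\ell}_{\sigma_\nu(i)}(\nu)=\begin{cases}\bar c_{\sigma_\nu(i)}(\nu)+\Delta c_{\sigma_\nu(i)}(\nu)-\Delta c_{\sigma_\nu(\ell)}(\nu),&1\le i\le\ell,\\ \bar c_{\sigma_\nu(i)}(\nu),&\ell+1\le i\le n,\end{cases}\qquad \kappa_\ell(\nu)=\Gamma\,\Delta c_{\sigma_\nu(\ell)}(\nu)-k\nu,$$ and $$M(\nu)=\max_{\ell\in\mathcal L}\Big\{\Gamma\,\Delta c_{\sigma_\nu(\ell)}(\nu)+\sum_{i=1}^n\max\{0,\tilde c^{\,\ell}_{\sigma_\nu(i)}(\nu)\}\Big\}.$$ In (Q), $y=(y^\nu)_{\nu\in\mathcal V}$ and $y^\nu=(y^\nu_\ell)_{\ell\in\mathcal L}$. ($M(\nu)$ is unrelated to the number $M$ of scenarios.) *)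

(* Defs.v *)
From HB Require Import structures.
From mathcomp Require Import all_boot all_order all_algebra all_fingroup.
From mathcomp Require Import reals.

Set Implicit Arguments.
Unset Strict Implicit.
Unset Printing Implicit Defensive.

Import Order.TTheory GRing.Theory Num.Theory.
Local Open Scope ring_scope.

(* The ground set {1, ..., n} is 'I_n, so the item (or position) i of the
   mathematical text has the value i - 1 here. *)

Definition binvec (n : nat) := {ffun 'I_n -> bool}.

Definition minimizer (R : realType) (T : Type)
    (feas : T -> Prop) (obj : T -> R) (z : T) : Prop :=
  feas z /\ forall z', feas z' -> obj z <= obj z'.

Definition optimal_value (R : realType) (T : Type)
    (feas : T -> Prop) (obj : T -> R) (v : R) : Prop :=
  exists2 z, minimizer feas obj z & obj z = v.

Definition lincost (R : realType) (n : nat) (c : 'I_n -> R) (x : binvec n) : R :=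
  \sum_(i < n) c i * (x i)%:R.

Definition budgeted (n Gamma : nat) : {set binvec n} :=
  [set u : binvec n | (\sum_(i < n) u i <= Gamma)%N].

Definition scenario (n Gamma : nat) := 'I_#|budgeted n Gamma|.

Definition scenario_cost (R : realType) (n Gamma : nat) (cbar dc : 'I_n -> R)
    (s : scenario n Gamma) : 'I_n -> R :=
  fun i => cbar i + dc i * (enum_val s i)%:R.

Definition recoverable (n k : nat) (x y : binvec n) : bool :=
  [forall i, (y i <= x i)%N]
  && (\sum_(i < n) x i <= \sum_(i < n) y i + k)%N.

(* The initial value of the iterated minimum is the value at y = x, which is
   always recoverable from x. *)
Definition recovery (R : realType) (n k : nat) (x : binvec n) (c : 'I_n -> R) : R :=
  \big[Num.min/lincost c x]_(y : binvec n | recoverable k x y) lincost c y.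

(* The initial value of the iterated maximum is the value in the scenario
   u = 0, which always belongs to the budgeted uncertainty set. *)
Definition worst_recovery (R : realType) (n Gamma k : nat) (cbar dc : 'I_n -> R)
    (x : binvec n) : R :=
  \big[Num.max/recovery k x cbar]_(s : scenario n Gamma)
     recovery k x (scenario_cost cbar dc s).

Definition P_feas (n : nat) (X : {set binvec n}) (x : binvec n) : Prop :=
  x \in X.

Definition P_obj (R : realType) (n Gamma k : nat) (f cbar dc : 'I_n -> R)
    (x : binvec n) : R :=
  lincost f x + worst_recovery Gamma k cbar dc x.

Definition Vseq (R : realType) (n : nat) (cbar dc : 'I_n -> R) : seq R :=
  0 :: [seq cbar i | i : 'I_n] ++ [seq cbar i + dc i | i : 'I_n].

(* The finite type of the elements of the set V; val : Vset _ _ -> R. *)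
Definition Vset (R : realType) (n : nat) (cbar dc : 'I_n -> R) :=
  seq_sub (Vseq cbar dc).

Definition cbar_nu (R : realType) (n : nat) (cbar : 'I_n -> R) (nu : R)
    (i : 'I_n) : R :=
  if nu < cbar i then nu else cbar i.

Definition dc_nu (R : realType) (n : nat) (cbar dc : 'I_n -> R) (nu : R)
    (i : 'I_n) : R :=
  if nu < cbar i then 0 else Num.min (dc i) (nu - cbar i).

(* The extended positions {1, ..., n+1} are 'I_n.+1, again shifted by one, so
   that the position n+1 is ord_max. *)
Definition Lset (n Gamma : nat) : {set 'I_n.+1} :=
  [set l : 'I_n.+1 | (l.+1 == n.+1)
     || [&& (Gamma < l.+1)%N, odd (l.+1 - Gamma) & (l.+1 < n.+1)%N]].

Definition Lidx (n Gamma : nat) := {l : 'I_n.+1 | l \in Lset n Gamma}.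

(* The deviation of the item at extended position l of the ordering s; it is 0
   at the position n+1. *)
Definition dc_pos (R : realType) (n : nat) (cbar dc : 'I_n -> R) (nu : R)
    (s : 'S_n) (l : 'I_n.+1) : R :=
  if insub (val l) is Some i then dc_nu cbar dc nu (s i) else 0.

(* The modified cost of the item s i, as a function of its position i. *)
Definition ctilde (R : realType) (n : nat) (cbar dc : 'I_n -> R) (nu : R)
    (s : 'S_n) (l : 'I_n.+1) (i : 'I_n) : R :=
  if (i <= l)%N
  then cbar_nu cbar nu (s i) + dc_nu cbar dc nu (s i) - dc_pos cbar dc nu s l
  else cbar_nu cbar nu (s i).

Definition kappa (R : realType) (n Gamma k : nat) (cbar dc : 'I_n -> R) (nu : R)
    (s : 'S_n) (l : 'I_n.+1) : R :=
  Gamma%:R * dc_pos cbar dc nu s l - k%:R * nu.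

(* The initial value of the iterated maximum is the term of l = n+1, which
   belongs to Lset. *)
Definition bigM (R : realType) (n Gamma : nat) (cbar dc : 'I_n -> R) (nu : R)
    (s : 'S_n) : R :=
  let term l := Gamma%:R * dc_pos cbar dc nu s l
                + \sum_(i < n) Num.max 0 (ctilde cbar dc nu s l i) in
  \big[Num.max/term ord_max]_(l in Lset n Gamma) term l.

Definition Qvar (R : realType) (n Gamma : nat) (cbar dc : 'I_n -> R) : Type :=
  (binvec n * R * {ffun Vset cbar dc -> {ffun Lidx n Gamma -> bool}})%type.

Definition Q_feas (R : realType) (n Gamma k : nat) (X : {set binvec n})
    (cbar dc : 'I_n -> R) (sigma : Vset cbar dc -> 'S_n)
    (z : Qvar Gamma cbar dc) : Prop :=
  let: (x, eta, y) := z in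
  [/\ x \in X,
      0 <= eta,
      forall nu : Vset cbar dc, (\sum_(l : Lidx n Gamma) y nu l = 1)%N
    & forall (nu : Vset cbar dc) (l : Lidx n Gamma),
        kappa Gamma k cbar dc (val nu) (sigma nu) (val l)
        + \sum_(i < n) ctilde cbar dc (val nu) (sigma nu) (val l) i
                       * (x (sigma nu i))%:R
        - bigM Gamma cbar dc (val nu) (sigma nu) * (1 - (y nu l)%:R)
        <= eta].

Definition Q_obj (R : realType) (n Gamma : nat) (f cbar dc : 'I_n -> R)
    (z : Qvar Gamma cbar dc) : R :=
  let: (x, eta, _) := z in lincost f x + eta.

(* Main.v *)
Require Import Defs.
From HB Require Import structures.
From mathcomp Require Import all_boot all_order all_algebra all_fingroup.
From mathcomp Require Import reals.
From mathcomp Require Import ring lra zify.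
Import Order.TTheory GRing.Theory Num.Theory.
Local Open Scope ring_scope.

Set Implicit Arguments.
Unset Strict Implicit.
Unset Printing Implicit Defensive.

(** The recovery problem in a fixed scenario is a selection problem, so linear
programming duality with one multiplier [nu] for the cardinality constraint
gives
   [recovery k x c = max_(nu >= 0) (\sum_i min (nu, c_i) x_i - k nu)],
and an optimal [nu] can be found among 0 and the costs [c_i]: it is the largest
cost of an item that is kept, or 0 if no item has to be kept
([recovery_dual_le], [recovery_dual_attained]).
All these candidates lie in the finite set [Vseq], whatever the scenario is.

For a fixed [nu], the truncated scenario cost [min (nu, cbar_i + dc_i u_i)] is
affine in the bit [u_i]; its coefficients are [cbar_nu] and [dc_nu]
([min_scenario_cost]). The adversary therefore maximizes
[\sum_i dc_nu_i u_i x_i] over [\sum_i u_i <= Gamma], again a selection problem,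
whose dual has a threshold [t >= 0] and the objective
[Gamma t + \sum_i max (0, dc_nu_i - t) x_i]. With the items sorted by deviation,
the thresholds of interest are the deviations at the positions [l]. The dual
objective at [l], plus the terms that do not depend on [u], is the row [(nu, l)]
of the mixed-integer program without its big-M term. Hence every row dominates the
adversary ([dual_le_row]), and some row is attained ([row_attained]). An
attaining position can be taken in the sparse set [Lset]: if [p] positions
contain exactly [Gamma] selected items, then both the last of them and the next
one are optimal, and one of these two has the required parity. If fewer than
[Gamma] items are selected, the position [n + 1], of deviation 0, is optimal.

Together, [worst_recovery] is a maximum over [nu] of a minimum over [l] of rows.
The binary variables of the program choose the row that realizes the minimum
for each [nu], and [bigM] is large enough to make the other rows nonpositive
([row_sub_bigM]). So, for each [x], the smallest feasible [eta] equals
[worst_recovery] ([worst_recovery_le_eta], [exists_feas_worst]), and both claims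
follow. *)

(** * Duality for the recovery problem *)

Definition recovery_dual (R : realType) (n k : nat) (x : binvec n)
    (c : 'I_n -> R) (nu : R) : R :=
  \sum_(i < n) Num.min nu (c i) * (x i)%:R - k%:R * nu.

(** Item by item: an item of [x] costs at least [min nu c_i] if it is kept, and
[nu] pays for it if it is dropped; at most [k] items are dropped. *)
Lemma recovery_dual_le (R : realType) (n k : nat) (x y : binvec n)
    (c : 'I_n -> R) (nu : R) :
  0 <= nu -> recoverable k x y -> recovery_dual k x c nu <= lincost c y.
Proof.
move=> nu_ge0 /andP[/forallP yx xk].
have xkR : (\sum_(i < n) (x i)%:R : R) <= \sum_(i < n) (y i)%:R + k%:R.
  rewrite -!natr_sum -natrD ler_nat; exact: xk.
have : \sum_(i < n) Num.min nu (c i) * (x i)%:R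
       <= lincost c y + nu * (\sum_(i < n) (x i)%:R - \sum_(i < n) (y i)%:R).
  rewrite mulrBr !mulr_sumr -sumrB /lincost -big_split; apply: ler_sum => i _ /=.
  have := yx i; case: (x i); case: (y i) => //= _;
    rewrite ?(mulr1, mulr0, subr0, subrr, addr0, add0r) //.
    by rewrite ge_min lexx orbT.
  by rewrite ge_min lexx.
rewrite /recovery_dual; nra.
Qed.

Lemma recovery_dual_le_recovery (R : realType) (n k : nat) (x : binvec n)
    (c : 'I_n -> R) (nu : R) :
  0 <= nu -> recovery_dual k x c nu <= recovery k x c.
Proof.
move=> nu_ge0; apply/bigmin_geP; split=> [|y]; last exact: recovery_dual_le.
apply: recovery_dual_le => //; apply/andP; split; last exact: leq_addr.
by apply/forallP.
Qed.

Lemma smallest_subset (R : realType) (T : finType) (c : T -> R) (A : {set T})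
    (m : nat) :
  (m <= #|A|)%N ->
  exists B : {set T}, [/\ B \subset A, #|B| = m
    & forall i j, i \in B -> j \in A :\: B -> c i <= c j].
Proof.
elim: m => [|m IHm] mA.
  by exists set0; split; rewrite ?sub0set ?cards0 // => i j; rewrite inE.
have [B [BA Bm Bmin]] := IHm (ltnW mA).
have [j0 j0AB] : exists j, j \in A :\: B.
  by apply/set0Pn; rewrite -card_gt0 cardsD (setIidPr BA) Bm subn_gt0.
have [a aAB amin] := @arg_minP _ _ _ j0 (fun j => j \in A :\: B) c j0AB.
move: (aAB); rewrite in_setD => /andP[aB aA].
exists (a |: B); split.
- by apply/subsetP => i; rewrite !inE => /orP[/eqP->//|]; apply: (subsetP BA).
- by rewrite cardsU1 aB Bm.
move=> i j; rewrite !inE negb_or => /orP[/eqP->|iB] /andP[/andP[ja jB] jA].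
  by apply: amin; rewrite /= inE jB.
by apply: Bmin; rewrite // inE jB.
Qed.

(** Complementary slackness: drop [k] items of largest cost and let [nu] be the
largest cost that remains, or 0 if all items may be dropped. *)
Lemma recovery_dual_attained (R : realType) (n k : nat) (x : binvec n)
    (c : 'I_n -> R) :
  (forall i, 0 <= c i) ->
  exists2 nu, nu = 0 \/ (exists i, nu = c i)
            & recovery k x c <= recovery_dual k x c nu.
Proof.
move=> c_ge0; pose A := [set i | x i].
have cardA : #|A| = (\sum_(i < n) x i)%N.
  by rewrite -sum1_card big_mkcond; apply: eq_bigr => i _; rewrite inE; case: (x i).
have [B [BA Bm Bmin]] := @smallest_subset R _ c A (#|A| - k) (leq_subr _ _).
pose y : binvec n := [ffun i => i \in B].
have cardB : (\sum_(i < n) y i)%N = (#|A| - k)%N.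
  rewrite -Bm -sum1_card [RHS]big_mkcond; apply: eq_bigr => i _.
  by rewrite ffunE; case: (i \in B).
have yx i : (y i <= x i)%N.
  rewrite ffunE; case: (boolP (i \in B)) => // /(subsetP BA).
  by rewrite inE => ->.
have yrec : recoverable k x y.
  apply/andP; split; first exact/forallP.
  by rewrite cardB -cardA addnC -leq_subLR.
have rec_le : recovery k x c <= lincost c y by apply: bigmin_le_cond.
have [B0|[i0 i0B]] := set_0Vmem B.
  exists 0; first by left.
  apply: (le_trans rec_le); rewrite /recovery_dual mulr0 subr0.
  apply: ler_sum => i _; rewrite ffunE B0 inE mulr0.
  by rewrite mulr_ge0 // le_min lexx c_ge0.
have [b bB bmax] := @arg_maxP _ _ _ i0 (fun j => j \in B) c i0B.
exists (c b); first by right; exists b.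
apply: (le_trans rec_le).
have kA : (k <= #|A|)%N.
  rewrite leqNgt; apply/negP => /ltnW; rewrite -subn_eq0 -Bm cards_eq0.
  by move=> /eqP B0; rewrite B0 inE in i0B.
have kE : k%:R = \sum_(i < n) (x i)%:R - \sum_(i < n) (y i)%:R :> R.
  by rewrite -!natr_sum cardB -cardA natrB // opprB addrC subrK.
rewrite /recovery_dual kE mulrBl !mulr_suml -sumrB -sumrB /lincost.
apply: ler_sum => i _; rewrite ffunE.
have [iB|iB] := boolP (i \in B).
  have := subsetP BA i iB; rewrite inE => ->.
  by rewrite (min_idPr (bmax i iB)) /= subrr subr0.
case: (boolP (x i)) => xi; last by rewrite !(mulr0, mul0r, subr0).
have : c b <= c i by apply: Bmin; rewrite // !inE iB.
by move/min_idPl->; rewrite !(mulr0, mul1r, mul0r, mulr1, subr0) subrr.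
Qed.

(** * The rows of the program for a fixed multiplier *)

Definition row_value (R : realType) (n Gamma k : nat) (cbar dc : 'I_n -> R) (nu : R)
    (s : 'S_n) (l : 'I_n.+1) (x : binvec n) : R :=
  kappa Gamma k cbar dc nu s l
  + \sum_(i < n) ctilde cbar dc nu s l i * (x (s i))%:R.

(** Truncation at [nu] keeps the cost affine in the bit of the scenario. This is
what makes the inner maximization over scenarios a selection problem. *)
Lemma min_scenario_cost (R : realType) (n : nat) (cbar dc : 'I_n -> R)
    (nu : R) (i : 'I_n) (b : bool) :
  0 <= dc i ->
  Num.min nu (cbar i + dc i * b%:R)
  = cbar_nu cbar nu i + dc_nu cbar dc nu i * b%:R.
Proof.
move=> dc_ge0; rewrite /cbar_nu /dc_nu.
case: b; rewrite ?(mulr1, mulr0, addr0); case: ltP => // h.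
- by rewrite addr0 min_l //; lra.
- by rewrite addr_minr [cbar i + (nu - _)]addrC subrK minC.
Qed.

Lemma dc_nu_ge0 (R : realType) (n : nat) (cbar dc : 'I_n -> R) (nu : R)
    (i : 'I_n) :
  0 <= dc i -> 0 <= dc_nu cbar dc nu i.
Proof.
by move=> dc_ge0; rewrite /dc_nu; case: ltP => // h; rewrite le_min dc_ge0 subr_ge0.
Qed.

Lemma dc_pos_val (R : realType) (n : nat) (cbar dc : 'I_n -> R) (nu : R)
    (s : 'S_n) (l : 'I_n.+1) (i : 'I_n) :
  val i = val l -> dc_pos cbar dc nu s l = dc_nu cbar dc nu (s i).
Proof. by move=> il; rewrite /dc_pos -il valK. Qed.

Lemma dc_pos_max (R : realType) (n : nat) (cbar dc : 'I_n -> R) (nu : R)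
    (s : 'S_n) :
  dc_pos cbar dc nu s ord_max = 0.
Proof. by rewrite /dc_pos insubN //= ltnn. Qed.

Definition sorted_deviations (R : realType) (n : nat) (cbar dc : 'I_n -> R) (nu : R)
    (s : 'S_n) : Prop :=
  forall i j : 'I_n, (i <= j)%N ->
    dc_nu cbar dc nu (s j) <= dc_nu cbar dc nu (s i).

Lemma dc_pos_bounds (R : realType) (n : nat) (cbar dc : 'I_n -> R) (nu : R)
    (s : 'S_n) (l : 'I_n.+1) :
  (forall i, 0 <= dc i) -> sorted_deviations cbar dc nu s ->
  [/\ 0 <= dc_pos cbar dc nu s l,
      forall i : 'I_n, (i <= l)%N -> dc_pos cbar dc nu s l <= dc_nu cbar dc nu (s i)
    & forall i : 'I_n, (l <= i)%N -> dc_nu cbar dc nu (s i) <= dc_pos cbar dc nu s l].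
Proof.
move=> dc_ge0 srt; have [ln|nl] := ltnP l n.
  rewrite (@dc_pos_val _ _ _ _ _ _ l (Ordinal ln)) //.
  split=> [|i il|i li]; first exact: dc_nu_ge0.
      exact: (srt i (Ordinal ln) il).
    exact: (srt (Ordinal ln) i li).
have -> : l = ord_max by apply/val_inj/eqP; rewrite eqn_leq /= nl -ltnS ltn_ord.
rewrite dc_pos_max; split=> // i; first by move=> _; exact: dc_nu_ge0.
by rewrite leqNgt ltn_ord.
Qed.

Definition item_cost (R : realType) (n : nat) (cbar dc : 'I_n -> R)
    (u : binvec n) (i : 'I_n) : R := cbar i + dc i * (u i)%:R.

(** The gap between a row and the dual value of a scenario, written as a sum of
complementary slackness terms: the unused budget, and one term per item. Both
weak and strong duality of the adversary's problem are read off from it. *)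
Lemma row_sub_dual (R : realType) (n Gamma k : nat) (cbar dc : 'I_n -> R)
    (nu : R) (s : 'S_n) (l : 'I_n.+1) (x u : binvec n) :
  (forall i, 0 <= dc i) ->
  let t := dc_pos cbar dc nu s l in
  row_value Gamma k cbar dc nu s l x - recovery_dual k x (item_cost cbar dc u) nu
  = t * (Gamma%:R - \sum_(i < n) (u i)%:R)
    + \sum_(i < n) (t * (u (s i))%:R
         + ((if (i <= l)%N then dc_nu cbar dc nu (s i) - t else 0)
            - dc_nu cbar dc nu (s i) * (u (s i))%:R) * (x (s i))%:R).
Proof.
move=> dc_ge0 t.
have -> : recovery_dual k x (item_cost cbar dc u) nu
        = \sum_(i < n) (cbar_nu cbar nu (s i)
            + dc_nu cbar dc nu (s i) * (u (s i))%:R) * (x (s i))%:R - k%:R * nu.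
  rewrite /recovery_dual (reindex_inj (@perm_inj _ s)) /=; congr (_ - _).
  by apply: eq_bigr => i _; rewrite min_scenario_cost.
rewrite /row_value /kappa -/t [X in t * (_ - X)](reindex_inj (@perm_inj _ s)) /=.
rewrite mulrBr mulr_sumr.
set S1 := \sum_(i < n) ctilde _ _ _ _ _ _ * _; set S2 := \sum_(i < n) (_ + _) * _.
set S3 := \sum_(i < n) t * _; set S4 := \sum_(i < n) _.
have : S1 - S2 = S4 - S3.
  rewrite /S1 /S2 /S3 /S4 -!sumrB; apply: eq_bigr => i _.
  by rewrite /ctilde -/t; case: ifP => _; ring.
by move=> ?; lra.
Qed.

(** Weak duality of the adversary's problem: each term of the gap is nonnegative,
because the deviations are at least the threshold up to position [l] and at most
the threshold from position [l] on. *)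
Lemma dual_le_row (R : realType) (n Gamma k : nat) (cbar dc : 'I_n -> R)
    (nu : R) (s : 'S_n) (l : 'I_n.+1) (x u : binvec n) :
  (forall i, 0 <= dc i) -> sorted_deviations cbar dc nu s -> u \in budgeted n Gamma ->
  recovery_dual k x (item_cost cbar dc u) nu <= row_value Gamma k cbar dc nu s l x.
Proof.
move=> dc_ge0 srt; rewrite inE => uG.
have [t_ge0 t_le t_ge] := dc_pos_bounds l dc_ge0 srt.
rewrite -subr_ge0 row_sub_dual //; apply: addr_ge0.
  by rewrite mulr_ge0 // subr_ge0 -natr_sum ler_nat.
apply: sumr_ge0 => i _; have := dc_nu_ge0 cbar nu (dc_ge0 (s i)).
have := t_le i; have := t_ge i.
case: (leqP i l) => il; [move=> _ /(_ isT) | move=> /(_ (ltnW il)) + _];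
  by case: (u (s i)); case: (x (s i)) => /=; lra.
Qed.

(** A discrete intermediate value argument: the number of selected items among
the first [p] positions grows by at most one with [p], so it cannot jump over
[Gamma]. *)
Lemma prefix_threshold (n Gamma : nat) (x : 'I_n -> bool) :
  exists p : 'I_n.+1,
    (\sum_(i < n) (x i && (i < p)) <= Gamma)%N
    /\ (p = n :> nat \/ (\sum_(i < n) (x i && (i < p)))%N = Gamma).
Proof.
pose F q := (\sum_(i < n) (x i && (i < q)))%N.
have FS q : (F q.+1 <= (F q).+1)%N.
  have [qn|nq] := ltnP q n.
    rewrite /F (bigD1 (Ordinal qn)) //= [X in (_ <= X.+1)%N](bigD1 (Ordinal qn)) //=.
    rewrite ltnn andbF add0n -[X in (_ <= X)%N]add1n leq_add ?leq_b1 //.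
    apply: leq_sum => i iq; rewrite [(i < q.+1)%N]ltnS [(i <= q)%N]leq_eqVlt.
    by have /negPf-> : (i : nat) != q by exact: iq.
  apply/leqW/leq_sum => i _.
  by rewrite ltnS !(leq_trans (ltn_ord i)) ?(ltnW (leq_trans (ltn_ord i) nq)).
have F0 : F 0%N = 0%N by rewrite /F big1 // => i _; rewrite ltn0 andbF.
have step q : (q <= n)%N -> exists2 p, (p <= q)%N
    & (F p <= Gamma)%N /\ (p = q \/ F p = Gamma).
  elim: q => [|q IHq] qn; first by exists 0%N; rewrite ?F0; auto.
  have [p pq [Fp [pE|pE]]] := IHq (ltnW qn); last by exists p; auto; exact: leqW.
  have [FG|FG] := eqVneq (F p) Gamma; first by exists p; auto; exact: leqW.
  exists q.+1 => //; split; last by left.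
  by rewrite (leq_trans (FS q)) // -pE ltn_neqAle FG.
have [p pn [Fp pE]] := step n (leqnn n).
by exists (Ordinal (pn : (p < n.+1)%N)).
Qed.

(** Strong duality of the adversary's problem: the adversary raises the first
[Gamma] selected items in the order of [s]. With [p] the length of the prefix
that contains them, all terms of the gap vanish both for the [p]-th position and
for the position after it; the parity condition that defines [Lset] selects one
of the two. When [p = n], the position after it is [n + 1]: it always belongs to
[Lset], and its threshold 0 makes the unused budget free, so that this case also
covers fewer than [Gamma] selected items. *)
Lemma row_attained (R : realType) (n Gamma k : nat) (cbar dc : 'I_n -> R)
    (nu : R) (s : 'S_n) (x : binvec n) :
  (forall i, 0 <= dc i) -> (Gamma <= n)%N ->
  exists2 l, l \in Lset n Gamma & exists2 u, u \in budgeted n Gamma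
    & row_value Gamma k cbar dc nu s l x
      = recovery_dual k x (item_cost cbar dc u) nu.
Proof.
move=> dc_ge0 Gn.
have [p [pG pE]] := prefix_threshold Gamma (fun i => x (s i)).
pose u : binvec n := [ffun j => x j && ((s^-1)%g j < p)%N].
have uE i : u (s i) = x (s i) && (i < p)%N by rewrite ffunE permK.
have usum : (\sum_(i < n) u i = \sum_(i < n) (x (s i) && (i < p)))%N.
  by rewrite (reindex_inj (@perm_inj _ s)); apply: eq_bigr => i _; rewrite uE.
have Gp : (Gamma <= p)%N.
  case: pE => [->//|<-].
  rewrite -[X in (_ <= X)%N]card_ord -sum1_card.
  rewrite (big_ord_widen n (fun=> 1%N)); last by rewrite -ltnS ltn_ord.
  rewrite [X in (_ <= X)%N]big_mkcond.
  by apply: leq_sum => i _ /=; case: (x (s i)); case: (i < p)%N.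
have [l lL [lp tG]] : exists2 l : 'I_n.+1, l \in Lset n Gamma
    & (val l = p \/ (val l).+1 = p)
      /\ (l = ord_max \/ (\sum_(i < n) u i)%N = Gamma).
  (* Positions count from 0 here, so the value [p] is the position after the
     prefix, and [p.-1] is the last position of the prefix. *)
  rewrite usum; have [pn|pn] := eqVneq (p : nat) n.
    exists p; first by rewrite inE pn eqxx.
    by split; left; [|apply: val_inj].
  have {pE}pE : (\sum_(i < n) (x (s i) && (i < p)))%N = Gamma.
    by case: pE => // pE; rewrite pE eqxx in pn.
  have p_lt : (p < n)%N by rewrite ltn_neqAle pn -ltnS ltn_ord.
  have [odd_p|even_p] := boolP (odd (p - Gamma)).
    have p_gt : (Gamma < p)%N by rewrite ltnNge -subn_eq0; case: (p - Gamma)%N odd_p.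
    have q_lt : (p.-1 < n.+1)%N by lia.
    exists (Ordinal q_lt); last by split; right; rewrite //= prednK //; lia.
    by rewrite inE /= prednK ?p_gt ?odd_p; lia.
  exists p; last by split; [left|right].
  by rewrite inE subSn //= even_p !ltnS Gp p_lt orbT.
exists l => //; exists u; first by rewrite inE usum.
apply/eqP; rewrite -subr_eq0 row_sub_dual // [X in _ + X]big1 => [|i _].
  case: tG => [->|<-]; first by rewrite dc_pos_max mul0r addr0.
  by rewrite -natr_sum subrr mulr0 addr0.
rewrite uE.
have [il|il|il] := ltngtP i l.
- have -> : (i < p)%N by case: lp => <- //; exact: ltnW.
  by case: (x (s i)) => /=; ring.
- have -> : (i < p)%N = false by case: lp => <-; apply/negbTE; rewrite -leqNgt // ltnW.
  by rewrite andbF /=; ring.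
- rewrite (dc_pos_val _ _ _ _ il).
  by case: (x (s i)); case: (i < p)%N => /=; ring.
Qed.

(** The big-M term outweighs everything in a row but [- k nu]. *)
Lemma row_sub_bigM (R : realType) (n Gamma k : nat) (cbar dc : 'I_n -> R)
    (nu : R) (s : 'S_n) (l : 'I_n.+1) (x : binvec n) :
  l \in Lset n Gamma ->
  row_value Gamma k cbar dc nu s l x - bigM Gamma cbar dc nu s <= - (k%:R * nu).
Proof.
move=> lL; pose term l' := Gamma%:R * dc_pos cbar dc nu s l'
  + \sum_(i < n) Num.max 0 (ctilde cbar dc nu s l' i).
have : term l <= bigM Gamma cbar dc nu s by apply: (le_bigmax_cond _ term).
rewrite /term /row_value /kappa.
have : \sum_(i < n) ctilde cbar dc nu s l i * (x (s i))%:R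
       <= \sum_(i < n) Num.max 0 (ctilde cbar dc nu s l i).
  apply: ler_sum => i _.
  by case: (x (s i)); rewrite ?(mulr1, mulr0) le_max lexx ?orbT.
lra.
Qed.

(** * The worst case over scenarios, and the set of multipliers *)

Lemma eq_recovery (R : realType) (n k : nat) (x : binvec n) (c c' : 'I_n -> R) :
  c =1 c' -> recovery k x c = recovery k x c'.
Proof.
move=> cE; have lE y : lincost c y = lincost c' y.
  by apply: eq_bigr => i _; rewrite cE.
by rewrite /recovery lE; apply: eq_bigr => y _.
Qed.

Lemma recovery_le_worst (R : realType) (n Gamma k : nat) (cbar dc : 'I_n -> R)
    (x u : binvec n) :
  u \in budgeted n Gamma ->
  recovery k x (item_cost cbar dc u) <= worst_recovery Gamma k cbar dc x.
Proof.
move=> uU; rewrite -(enum_rankK_in uU uU).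
exact: (le_bigmax _ (fun s => recovery k x (scenario_cost cbar dc s))).
Qed.

Lemma worst_recovery_le (R : realType) (n Gamma k : nat) (cbar dc : 'I_n -> R)
    (x : binvec n) (v : R) :
  (forall u, u \in budgeted n Gamma -> recovery k x (item_cost cbar dc u) <= v) ->
  worst_recovery Gamma k cbar dc x <= v.
Proof.
move=> le_v; apply: bigmax_le => [|s _]; last exact/le_v/enum_valP.
rewrite (_ : recovery k x cbar = recovery k x (item_cost cbar dc [ffun=> false])).
  by apply: le_v; rewrite inE big1 // => i _; rewrite ffunE.
by apply: eq_recovery => i; rewrite /item_cost ffunE mulr0 addr0.
Qed.

Lemma mem_Vseq_cost (R : realType) (n : nat) (cbar dc : 'I_n -> R) (u : binvec n)
    (i : 'I_n) :
  item_cost cbar dc u i \in Vseq cbar dc.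
Proof.
rewrite inE mem_cat /item_cost; case: (u i); rewrite ?(mulr1, mulr0, addr0).
  by rewrite [X in [|| _, _ | X]]image_f ?orbT.
by rewrite image_f ?orbT.
Qed.

Lemma Vset_ge0 (R : realType) (n : nat) (cbar dc : 'I_n -> R) (nu : Vset cbar dc) :
  (forall i, 0 <= cbar i) -> (forall i, 0 <= dc i) -> 0 <= val nu.
Proof.
move=> cbar_ge0 dc_ge0; have := valP nu; rewrite /= inE mem_cat.
by case/or3P=> [/eqP->//|/imageP[i _ ->]|/imageP[i _ ->]]; rewrite ?addr_ge0.
Qed.

(** * The smallest feasible [eta] *)

(** Every scenario has an optimal multiplier [nu] in [Vset]; the row that [y]
chooses for this [nu] carries no big-M term, so it bounds the recovery cost in the scenario by [eta]. *)
Lemma worst_recovery_le_eta (R : realType) (n Gamma k : nat) (X : {set binvec n})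
    (cbar dc : 'I_n -> R) (sigma : Vset cbar dc -> 'S_n) (x : binvec n) (eta : R) y :
  (forall i, 0 <= cbar i) -> (forall i, 0 <= dc i) ->
  (forall nu, sorted_deviations cbar dc (val nu) (sigma nu)) ->
  Q_feas k X sigma (x, eta, y : {ffun _ -> {ffun Lidx n Gamma -> bool}}) ->
  worst_recovery Gamma k cbar dc x <= eta.
Proof.
move=> cbar_ge0 dc_ge0 srt [_ _ y1 rows]; apply: worst_recovery_le => u uU.
have c_ge0 i : 0 <= item_cost cbar dc u i by rewrite addr_ge0 ?mulr_ge0.
have [nu nuE rec_le] := recovery_dual_attained k x c_ge0.
have nuV : nu \in Vseq cbar dc.
  by case: nuE => [->|[i ->]]; [rewrite inE eqxx | exact: mem_Vseq_cost].
pose v : Vset cbar dc := SeqSub nuV.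
have [l yl] : exists l, y v l.
  apply/existsP; rewrite -[[exists _, _]]negbK; apply/negP => /existsPn y0.
  by have := y1 v; rewrite big1 // => l _; rewrite (negPf (y0 l)).
apply: (le_trans rec_le).
apply: (le_trans (dual_le_row k (val l) x dc_ge0 (srt v) uU)).
by have := rows v l; rewrite yl /= subrr mulr0 subr0.
Qed.

Lemma worst_recovery_ge0 (R : realType) (n Gamma k : nat) (cbar dc : 'I_n -> R)
    (x : binvec n) :
  (forall i, 0 <= cbar i) -> 0 <= worst_recovery Gamma k cbar dc x.
Proof.
move=> cbar_ge0; apply: (@le_trans _ _ (recovery k x cbar)); last first.
  exact: bigmax_ge_id.
have lin_ge0 y : 0 <= lincost cbar y by apply: sumr_ge0 => i _; rewrite mulr_ge0.
by apply: le_bigmin.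
Qed.

(** For each [nu], let [y] choose an attained row: its value is a dual value of
some scenario, hence at most the worst recovery cost. The other rows are
nonpositive thanks to the big-M term. *)
Lemma exists_feas_worst (R : realType) (n Gamma k : nat) (X : {set binvec n})
    (cbar dc : 'I_n -> R) (sigma : Vset cbar dc -> 'S_n) (x : binvec n) :
  (forall i, 0 <= cbar i) -> (forall i, 0 <= dc i) -> (Gamma <= n)%N ->
  x \in X ->
  exists y : {ffun Vset cbar dc -> {ffun Lidx n Gamma -> bool}},
    Q_feas k X sigma (x, worst_recovery Gamma k cbar dc x, y).
Proof.
move=> cbar_ge0 dc_ge0 Gn xX.
have best nu : exists l : Lidx n Gamma,
    row_value Gamma k cbar dc (val nu) (sigma nu) (val l) x
    <= worst_recovery Gamma k cbar dc x.
  have [l lL [u uU rowE]] := row_attained k cbar (val nu) (sigma nu) x dc_ge0 Gn.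
  exists (Sub l lL); rewrite SubK rowE.
  apply: le_trans (recovery_le_worst k cbar dc x uU).
  exact/recovery_dual_le_recovery/Vset_ge0.
have [L LE] : exists L : {ffun Vset cbar dc -> Lidx n Gamma}, forall nu,
    row_value Gamma k cbar dc (val nu) (sigma nu) (val (L nu)) x
    <= worst_recovery Gamma k cbar dc x.
  exists [ffun nu => xchoose (best nu)] => nu; rewrite ffunE.
  exact: (xchooseP (best nu)).
exists [ffun nu => [ffun l => l == L nu]]; split=> //.
- exact: worst_recovery_ge0.
- move=> nu; rewrite (bigD1 (L nu)) //= !ffunE eqxx big1 ?addn0 // => l.
  by rewrite !ffunE => /negPf->.
move=> nu l; rewrite !ffunE; case: eqP => [->|_] /=.
  by rewrite subrr mulr0 subr0; exact: LE.
rewrite subr0 mulr1; apply: (le_trans (row_sub_bigM _ _ _ _ _ _ (valP l))).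
apply: le_trans (worst_recovery_ge0 _ _ _ _ cbar_ge0).
by rewrite oppr_le0 mulr_ge0 // Vset_ge0.
Qed.

(** * Equivalence of the two problems *)

Theorem theorem3 (R : realType) (n : nat) (n_ge1 : (1 <= n)%N)
    (X : {set binvec n}) (X_neq0 : X != set0)
    (f cbar dc : 'I_n -> R)
    (f_ge0 : forall i, 0 <= f i)
    (cbar_ge0 : forall i, 0 <= cbar i)
    (dc_ge0 : forall i, 0 <= dc i)
    (Gamma k : nat) (Gamma_le : (Gamma <= n)%N) (k_le : (k <= n)%N)
    (sigma : Vset cbar dc -> 'S_n)
    (sigma_sorted : forall (nu : Vset cbar dc) (i j : 'I_n), (i <= j)%N ->
       dc_nu cbar dc (val nu) (sigma nu j) <= dc_nu cbar dc (val nu) (sigma nu i)) :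
  (exists v : R,
     optimal_value (P_feas X) (P_obj Gamma k f cbar dc) v
     /\ optimal_value (Q_feas k X sigma) (@Q_obj R n Gamma f cbar dc) v)
  /\ (forall x : binvec n, x \in X ->
        (minimizer (P_feas X) (P_obj Gamma k f cbar dc) x
         <-> exists eta y,
               minimizer (Q_feas k X sigma) (@Q_obj R n Gamma f cbar dc)
                         (x, eta, y))).
Proof.
have below (z : Qvar Gamma cbar dc) : Q_feas k X sigma z ->
    P_feas X z.1.1 /\ P_obj Gamma k f cbar dc z.1.1 <= Q_obj f z.
  case: z => [[x eta] y] feas; split; first by case: feas.
  by rewrite lerD2l (worst_recovery_le_eta cbar_ge0 dc_ge0 _ feas).
have lift x : P_feas X x ->
    exists eta (y : {ffun Vset cbar dc -> {ffun Lidx n Gamma -> bool}}),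
      Q_feas k X sigma (x, eta, y)
      /\ Q_obj f (x, eta, y) = P_obj Gamma k f cbar dc x.
  move=> xX; exists (worst_recovery Gamma k cbar dc x).
  have [y feas] := exists_feas_worst k sigma cbar_ge0 dc_ge0 Gamma_le xX.
  by exists y.
have lift_min x : minimizer (P_feas X) (P_obj Gamma k f cbar dc) x ->
    exists eta y, minimizer (Q_feas k X sigma) (@Q_obj R n Gamma f cbar dc) (x, eta, y)
      /\ Q_obj f (x, eta, y) = P_obj Gamma k f cbar dc x.
  move=> [xX xmin]; have [eta [y [feas objE]]] := lift x xX.
  exists eta, y; split=> //; split=> // z /below[zX z_le].
  by rewrite objE; apply: le_trans z_le; exact: xmin.
split; last first.
  move=> x xX; split=> [/lift_min[eta [y [zmin _]]]|[eta [y [feas zmin]]]].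
    by exists eta, y.
  split=> // x' /lift[eta' [y' [feas' objE]]].
  by rewrite -objE; apply: le_trans (zmin _ feas'); case/below: feas.
have [x0 x0X] := set0Pn _ X_neq0.
pose x := [arg min_(x < x0 in X) P_obj Gamma k f cbar dc x]%O.
have xmin : minimizer (P_feas X) (P_obj Gamma k f cbar dc) x.
  by rewrite /x; case: arg_minP.
have [eta [y [zmin objE]]] := lift_min x xmin.
by exists (P_obj Gamma k f cbar dc x); split; [exists x | exists (x, eta, y)].
Qed.
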